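(* In every instance of fair division with market values with additive subjective utilities $(u_i)_{i\in\mathcal{N}}$ that are nonzero (that is, $u_i(g)>0$ for every agent $i$ and every good $g$) and an additive market valuation $v$, there exists an allocation that is fractionally Pareto optimal (fPO) with respect to the subjective utilities and EF1 with respect to the market valuation.
   Context: An instance of fair division with market values $\langle \mathcal{N}, \mathcal{M}, v, (u_i)_{i\in\mathcal{N}}\rangle$ consists of a finite set $\mathcal{N}$ of $n$ agents, a finite set $\mathcal{M}$ of $m$ indivisible goods, a market valuation $v:2^{\mathcal{M}}\to\mathbb{R}_{\ge 0}$, and a subjective utility function $u_i:2^{\mathcal{M}}\to\mathbb{R}_{\ge 0}$ for each agent $i$. Here all these set functions are additive: $f(S)=\sum_{g\in S} f(\{g\})$ for all $S\subseteq\mathcal{M}$, with $f(\emptyset)=0$; write $f(g)=f(\{g\})$. An allocation $A=(A_1,\dots,A_n)$ is a partition of $\mathcal{M}$ into $n$ pairwise disjoint (possibly empty) bundles, with $A_i$ given to agent $i$ and $\bigcup_i A_i=\mathcal{M}$. A fractional allocation is $A'\in[0,1]^{\mathcal{N}\times\mathcal{M}}$ with $\sum_{i\in\mathcal{N}}A'_{i,g}=1$ for each $g\in\mathcal{M}$; agent $i$'s utility in it is $u_i(A'_i)=\sum_{g\in\mathcal{M}}A'_{i,g}u_i(g)$. An (integral) allocation $A$ is fPO with respect to the subjective utilities if there is no fractional allocation $A'$ with $u_i(A'_i)\ge u_i(A_i)$ for all $i$ and at least one inequality strict. $A$ is EF1 with respect to the market valuation if for every $i,j\in\mathcal{N}$,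 either $A_j=\emptyset$ or $v(A_i)\ge v(A_j\setminus\{g\})$ for some $g\in A_j$. *)

(* Defs.v *)
From mathcomp Require Import all_boot all_order all_algebra.
From mathcomp Require Import reals.

Set Implicit Arguments.
Unset Strict Implicit.
Unset Printing Implicit Defensive.

Import Order.TTheory GRing.Theory Num.Theory.
Local Open Scope ring_scope.

Section FairDivision.
Context {R : realType} {N M : finType}.

(* At S = set0 this also gives f set0 = 0. *)
Definition additive_setfun (f : {set M} -> R) : Prop :=
  forall S : {set M}, f S = \sum_(g in S) f [set g].

(* An additive set function with values in the nonnegative reals. *)
Definition additive_valuation (f : {set M} -> R) : Prop :=
  (forall S : {set M}, 0 <= f S) /\ additive_setfun f.

(* Bundles may be empty, so this is not [finset.partition]. *)
Definition allocation (A : N -> {set M}) : Prop :=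
  (forall i j : N, i != j -> [disjoint A i & A j]) /\
  \bigcup_(i : N) A i = [set: M].

Definition fractional_allocation (A' : N -> M -> R) : Prop :=
  (forall (i : N) (g : M), 0 <= A' i g <= 1) /\
  (forall g : M, \sum_(i : N) A' i g = 1).

Definition fractional_utility (f : {set M} -> R) (x : M -> R) : R :=
  \sum_(g : M) x g * f [set g].

Definition fPO (u : N -> {set M} -> R) (A : N -> {set M}) : Prop :=
  ~ exists A' : N -> M -> R,
      [/\ fractional_allocation A',
          forall i : N, u i (A i) <= fractional_utility (u i) (A' i)
        & exists i : N, u i (A i) < fractional_utility (u i) (A' i)].

Definition EF1 (v : {set M} -> R) (A : N -> {set M}) : Prop :=
  forall i j : N,
    A j = set0 \/ exists2 g : M, g \in A j & v (A j :\ g) <= v (A i).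

End FairDivision.

(* Main.v *)
(* An allocation is fPO as soon as some positive agent weights [w] support it:
   each good [g] is held by an agent maximising [w h * u h g]. Perturbing [v], we
   may assume that every good has positive market value. Among supported
   allocations maximise the least market value [mu] of a bundle, then minimise
   the set [L] of agents whose bundle is worth [mu], and fix [i] in [L].
   Normalise [w i = 1] and choose the allocation and its weights with minimal
   total weight. By minimality, every agent of positive weight is reachable from
   [i] through steps [x -> k], where [k] holds a good for which [x] also attains
   the maximum, and this persists when goods are moved along such steps. If [k]
   violates EF1, the last good of a path from [i] to [k] can be moved one step
   back: [k] keeps more than [mu], and the receiver is not in [L], by minimality
   of [L]. Such a move never brings an agent closer to [i], and if all distances
   stay the same it brings the moved good closer, so a potential decreases and
   an allocation minimising it is EF1. *)
Require Import Defs.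
From mathcomp Require Import all_boot all_order all_algebra.
From mathcomp Require Import reals.
From mathcomp Require Import boolp.
From mathcomp Require Import lra.

Set Implicit Arguments.
Unset Strict Implicit.
Unset Printing Implicit Defensive.

Import Order.TTheory GRing.Theory Num.Theory.
Local Open Scope ring_scope.

(** * Minima over finite types and strict sums *)

Lemma fin_argmin d (T : finType) (O : orderType d) (P : T -> Prop) (f : T -> O) :
  (exists x, P x) -> exists2 x, P x & forall y, P y -> (f x <= f y)%O.
Proof.
case=> x0 /asboolP Px0.
case: (Order.TotalTheory.arg_minP (P := fun x => `[< P x >]) f Px0) => x /asboolP Px xmin.
by exists x => // y /asboolP; exact: xmin.
Qed.
Arguments fin_argmin {d T O P f}.

(** The cap 1 covers the case of no positive value and keeps [1 - e] nonnegative when weights are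
    scaled. *)
Lemma fin_pos_lbound (R : realDomainType) (T : finType) (f : T -> R) :
  exists2 e, 0 < e <= 1 & forall x, 0 < f x -> e <= f x.
Proof.
exists (\big[Num.min/1]_(x | 0 < f x) f x) => [|x fx]; last exact: bigmin_le_cond.
apply/andP; split; last exact: bigmin_le_id.
by elim/big_ind: _ => // x y x0 y0; rewrite lt_min x0.
Qed.

Lemma ltn_sum1 (I : finType) (F G : I -> nat) (j : I) :
  (forall i, F i <= G i)%N -> (F j < G j)%N ->
  (\sum_i F i < \sum_i G i)%N.
Proof.
move=> le_FG lt_FG; rewrite (bigD1 j) //= [X in (_ < X)%N](bigD1 j) //= -addSn.
by apply: leq_add => //; apply: leq_sum.
Qed.

Lemma ltr_sum1 (R : numDomainType) (I : finType) (F G : I -> R) (j : I) :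
  (forall i, F i <= G i) -> F j < G j -> \sum_i F i < \sum_i G i.
Proof.
move=> le_FG lt_FG; rewrite (bigD1 j) //= [ltRHS](bigD1 j) //=.
by apply: ltr_leD => //; apply: ler_sum.
Qed.

(** * Distances from agent [i] and the potential *)

Section Reach.
Context {N M : finType} (D : N -> M -> bool) (i : N).
Implicit Types (a : {ffun M -> N}) (g : M) (x : N).

Definition give a g x : {ffun M -> N} := [ffun h => if h == g then x else a h].

Definition grow a (X : {set N}) : {set N} :=
  i |: [set h | [exists x in X, exists g, (a g == h) && D x g]].

(** Agents at distance less than [q] from [i]: the iteration starts from the empty set, so [i]
    enters at [q = 1]. *)
Definition reach a q : {set N} := iter q (grow a) set0.

Lemma growP a (X : {set N}) h :
  reflect (h = i \/ exists x g, [/\ x \in X, a g = h & D x g]) (h \in grow a X).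
Proof.
rewrite !inE; apply: (iffP orP) => -[/eqP|]; try by left; try by apply/eqP.
  by case/exists_inP=> x xX /existsP[g /andP[/eqP ag Dxg]]; right; exists x, g.
case=> x [g [xX ag Dxg]]; right; apply/exists_inP; exists x => //.
by apply/existsP; exists g; rewrite ag eqxx.
Qed.

Lemma grow_mono a : {homo grow a : X Y / X \subset Y}.
Proof.
move=> X Y /subsetP XY; apply/subsetP => h /growP[->|[x [g [xX ag Dxg]]]].
  by apply/growP; left.
by apply/growP; right; exists x, g; split => //; apply: XY.
Qed.

Lemma reach_sub a p q : (p <= q)%N -> reach a p \subset reach a q.
Proof. exact: (subset_iter (@grow_mono a)). Qed.

Lemma reach_notin a p q x : x \in reach a p -> x \notin reach a q -> (q < p)%N.
Proof.
move=> xp; apply: contraNltn => /(reach_sub a) /subsetP; exact.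
Qed.

(** Whoever can step to [x] through [g] could formerly step to [a g], which is farther from [i] than
    [x]; so no distance decreases. *)
Lemma reach_give a g x q : x \in reach a q -> a g \notin reach a q ->
  forall p, reach (give a g x) p \subset reach a p.
Proof.
move=> xq agq; elim=> [|p /subsetP IH] //; apply/subsetP => h.
move=> /growP[->|[y [g' [yp <- Dyg]]]]; first by apply/growP; left.
have agp : a g' \in reach a p.+1 by apply/growP; right; exists y, g'; rewrite IH.
rewrite ffunE; case: eqP => // eg; rewrite {}eg in agp.
by apply: (subsetP (reach_sub a (ltnW (reach_notin agp agq)))).
Qed.

(* Lexicographic: the weight on the first sum exceeds the largest value of the
   second one. *)
Definition potential a : nat :=
  ((\sum_(q < #|N|.+1) #|reach a q|) * (#|M| * #|N|.+1).+1
   + \sum_g \sum_(q < #|N|.+1) (a g \notin reach a q))%N.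

(** If no [reach] set changes, [g] has come closer to [i] and the second sum drops. Otherwise some
    set shrinks, and the drop of the first term outweighs the second. *)
Lemma potential_give a g x (q : 'I_#|N|.+1) :
  x \in reach a q -> a g \notin reach a q ->
  (potential (give a g x) < potential a)%N.
Proof.
move=> xq agq; have sub := reach_give xq agq; rewrite /potential.
set a' := give a g x in sub *.
have [same|] := boolP [forall p : 'I_#|N|.+1, reach a' p == reach a p].
  have {}same (p : 'I_#|N|.+1) : reach a' p = reach a p.
    by apply/eqP/(forallP same).
  rewrite (eq_bigr _ (fun p _ => congr1 (fun X : {set N} => #|X|) (same p))).
  rewrite ltn_add2l.
  have xag (p : 'I_#|N|.+1) : (x \notin reach a p <= (a g \notin reach a p))%N.
    case: (boolP (x \in reach a p)) => //= xp.
    case: (boolP (a g \in reach a p)) => // agp.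
    have := ltn_trans (reach_notin xq xp) (reach_notin agp agq).
    by rewrite ltnn.
  apply: (ltn_sum1 (j := g)) => [g'|].
    by apply: leq_sum => p _; rewrite same ffunE; case: eqP => // ->.
  by apply: (ltn_sum1 (j := q)) => [p|]; rewrite same ffunE eqxx // xq agq.
rewrite negb_forall => /existsP[p neq_p].
have lt_reach : (\sum_(q < #|N|.+1) #|reach a' q| < \sum_(q < #|N|.+1) #|reach a q|)%N.
  apply: (ltn_sum1 (j := p)) => [r|]; first exact: subset_leq_card.
  by apply: proper_card; rewrite properEneq neq_p sub.
have le_level : (\sum_g' \sum_(q < #|N|.+1) (a' g' \notin reach a' q)
    <= #|M| * #|N|.+1)%N.
  apply: (@leq_trans (\sum_(g' : M) #|N|.+1)%N); last by rewrite sum_nat_const.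
  apply: leq_sum => g' _.
  apply: (@leq_trans (\sum_(r < #|N|.+1) 1)%N); last by rewrite sum1_card card_ord.
  by apply: leq_sum => r _; apply: leq_b1.
apply: (@leq_trans ((\sum_(q < #|N|.+1) #|reach a q|) * (#|M| * #|N|.+1).+1)%N);
  last exact: leq_addr.
apply: leq_trans (leq_mul lt_reach (leqnn _)).
by rewrite mulSn addnC ltn_add2r ltnS.
Qed.

Lemma reach_step a h : h \in fixset (grow a) -> h != i ->
  exists (q : 'I_#|N|.+1) x g,
    [/\ x \in reach a q, a g = h, D x g & h \notin reach a q].
Proof.
(* By definition, [fixset] is the iterate [reach a #|N|]. *)
move=> hfix hi; have ex_k : exists k, h \in reach a k by exists #|N|.
case: (ex_minnP ex_k) => -[|q] hq min_q; first by rewrite inE in hq.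
have ltqN : (q < #|N|.+1)%N by rewrite ltnW // ltnS min_q.
case/growP: hq => [/eqP|[x [g [xq ag Dxg]]]]; first by rewrite (negPf hi).
exists (Ordinal ltqN), x, g; split=> //=.
by apply/negP => /min_q; rewrite ltnn.
Qed.

End Reach.

(** * Supporting weights and their minimal choice *)

Section SupportingWeights.
Context {R : realType} {N M : finType} (u : N -> M -> R).
Hypothesis u_gt0 : forall h g, 0 < u h g.
Implicit Types (a : {ffun M -> N}) (g : M) (h i : N) (w : N -> R).

Definition desires w h g := [forall k, w k * u k g <= w h * u h g].

Definition supports w a := forall g, desires w (a g) g.

(** Zero weights are allowed so that the conditions survive pointwise infima. *)
Definition nweights i w a := [/\ forall h, 0 <= w h, w i = 1 & supports w a].

Lemma supportsP w a :
  supports w a <-> forall g h, w h * u h g <= w (a g) * u (a g) g.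
Proof. by split=> sw g; [apply/forallP/sw | apply/forallP => h; apply: sw]. Qed.

Lemma desires_lt w a h g : supports w a -> ~~ desires w h g ->
  w h * u h g < w (a g) * u (a g) g.
Proof.
move=> /supportsP sw; rewrite negb_forall => /existsP[k]; rewrite -ltNge.
by move=> /lt_le_trans; apply.
Qed.

Lemma supports_give w a g x : supports w a -> desires w x g ->
  supports w (give a g x).
Proof. by move=> sw dx g'; rewrite ffunE; case: eqP => [->|]. Qed.

Lemma nweights_holder_gt0 i w a g : nweights i w a -> 0 < w (a g).
Proof.
case=> _ wi /supportsP /(_ g i); rewrite wi mul1r => /(lt_le_trans (u_gt0 i g)).
by rewrite pmulr_lgt0.
Qed.

Lemma supports_scale w a i : (forall h, 0 < w h) -> supports w a ->
  nweights i (fun h => w h / w i) a.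
Proof.
move=> w_gt0 /supportsP sw; split=> [h||].
- by rewrite divr_ge0 ?ltW.
- by rewrite divff ?gt_eqF.
by apply/supportsP => g h; rewrite mulrAC [leRHS]mulrAC ler_pM2r ?invr_gt0.
Qed.

(* Only agents with empty bundles can have weight zero. *)
Lemma nweights_pos i w a : nweights i w a ->
  exists2 w', (forall h, 0 < w' h) & supports w' a.
Proof.
move=> nw; have [w_ge0 _ /supportsP sw] := nw.
(* Each ratio is the largest weight with which agent [hg.1] does not outbid the holder of good
   [hg.2]. *)
have [e /andP[e_gt0 _] e_le] :=
  fin_pos_lbound (fun hg : N * M => w (a hg.2) * u (a hg.2) hg.2 / u hg.1 hg.2).
exists (fun h => if w h == 0 then e else w h) => [h|].
  by case: eqP => // /eqP; rewrite lt_def w_ge0 andbT.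
apply/supportsP => g h; rewrite (gt_eqF (nweights_holder_gt0 g nw)).
case: ifP => _ //; rewrite -ler_pdivlMr //; apply: (e_le (h, g)) => /=.
by rewrite divr_gt0 ?mulr_gt0 ?(nweights_holder_gt0 g nw).
Qed.

Definition min_weights i a h : R :=
  inf (fun t => exists2 w, nweights i w a & w h = t).

Lemma min_weights_le i w a h : nweights i w a -> min_weights i a h <= w h.
Proof.
move=> nw; apply: ge_inf; last by exists w.
by exists 0 => _ [w' [w'_ge0 _ _] <-].
Qed.

(** Each support inequality bounds one weight by a multiple of a single other one, so it passes to
    coordinatewise infima. *)
Lemma min_weightsP i a : (exists w, nweights i w a) ->
  nweights i (min_weights i a) a.
Proof.
case=> w0 nw0.
have ge_min h t : (forall w, nweights i w a -> t <= w h) -> t <= min_weights i a h.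
  move=> t_le; apply: lb_le_inf; first by exists (w0 h), w0.
  by move=> _ [w nw <-]; apply: t_le.
split=> [h||]; first by apply: ge_min => w [].
  apply/eqP; rewrite eq_le; apply/andP; split.
    by case: (nw0) => _ <- _; apply: min_weights_le.
  by apply: ge_min => w [_ -> _].
apply/supportsP => g h; rewrite -ler_pdivrMr //; apply: ge_min => w nw.
have [_ _ /supportsP/(_ g h) sw] := nw; rewrite ler_pdivrMr //.
by apply: le_trans sw; rewrite ler_pM2r //; apply: min_weights_le.
Qed.

(* Otherwise the weights outside the reachable set could all be scaled down by a
   common factor [1 - e]. *)
Lemma minimal_weights_reach i w a : nweights i w a ->
  (forall w', nweights i w' a -> \sum_h w h <= \sum_h w' h) ->
  forall h, 0 < w h -> h \in fixset (grow (desires w) i a).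
Proof.
move=> nw w_min h wh_gt0; have [w_ge0 wi sw] := nw.
set X := fixset _; have XE : grow (desires w) i a X = X.
  exact: fixsetK (@grow_mono _ _ _ _ _).
apply/negPn/negP => hX.
have iX : i \in X by rewrite -XE; apply/growP; left.
(* [e] is at most every positive relative gap between a holder and another agent. Agents of [X]
   desire no good held outside [X], so after scaling none of them overtakes its holder. *)
have [e /andP[e_gt0 e_le1] e_le] := fin_pos_lbound
  (fun hg : N * M => 1 - w hg.1 * u hg.1 hg.2 / (w (a hg.2) * u (a hg.2) hg.2)).
pose w' k := if k \in X then w k else (1 - e) * w k.
have w'_le k : w' k <= w k.
  rewrite /w'; case: ifP => // _.
  by rewrite ler_piMl // lerBlDr lerDl ltW.
have nw' : nweights i w' a.
  split=> [k||].
  - by rewrite /w'; case: ifP => // _; rewrite mulr_ge0 // subr_ge0.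
  - by rewrite /w' iX.
  apply/supportsP => g k; have swgk := (supportsP _ _).1 sw g k.
  rewrite {2}/w'; case: ifP => agX.
    by apply: le_trans swgk; rewrite ler_pM2r.
  rewrite {1}/w'; case: ifP => kX; last by rewrite -!mulrA ler_wpM2l // subr_ge0.
  have lt_gk : w k * u k g < w (a g) * u (a g) g.
    apply: desires_lt => //; apply/negP => dkg; case/negP: agX.
    by rewrite -XE; apply/growP; right; exists k, g.
  have pos : 0 < w (a g) * u (a g) g by rewrite mulr_gt0 ?(nweights_holder_gt0 g nw).
  have /= := e_le (k, g); rewrite subr_gt0 ltr_pdivrMr // mul1r => /(_ lt_gk).
  by rewrite lerBrDl -lerBrDr ler_pdivrMr // mulrA.
have := w_min _ nw'; rewrite leNgt => /negP; apply.
apply: (ltr_sum1 (j := h)) => //; rewrite /w' (negPf hX).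
by rewrite gtr_pMl // ltrBlDr ltrDl.
Qed.

Lemma exists_supported : (0 < #|N|)%N ->
  exists a w, (forall h, 0 < w h) /\ supports w a.
Proof.
case/card_gt0P => h0 _; pose best g := [arg max_(h > h0) u h g]%O.
exists [ffun g => best g], (fun=> 1); split=> //.
apply/supportsP => g h; rewrite ffunE !mul1r /best.
by case: Order.TotalTheory.arg_maxP => // k _; apply.
Qed.

(** * EF1 for positive prices *)

Section Market.
Variable p : M -> R.
Hypothesis p_gt0 : forall g, 0 < p g.

Definition worth a h := \sum_(g | a g == h) p g.

Lemma worth_give a g x h :
  worth (give a g x) h = worth a h - (a g == h)%:R * p g + (x == h)%:R * p g.
Proof.
rewrite /worth !(big_mkcond (fun g' => _ == h)) /= (bigD1 g) //=.
rewrite [in RHS](bigD1 g) //= ffunE eqxx.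
rewrite (eq_bigr (fun g' => if a g' == h then p g' else 0)) => [|g' /negPf g'g].
  by case: (a g == h); case: (x == h) => /=; lra.
by rewrite ffunE g'g.
Qed.

Lemma market_EF1 : (0 < #|N|)%N ->
  exists a w, [/\ forall h, 0 < w h, supports w a
    & forall h k, (forall g, a g != k) \/
        exists2 g, a g = k & worth a k - p g <= worth a h].
Proof.
move=> N_gt0; have [h0 _] := card_gt0P N_gt0.
pose supported a := exists2 w, (forall h, 0 < w h) & supports w a.
have worst a : exists2 h, True & forall k, True -> worth a h <= worth a k.
  by apply: (fin_argmin (f := worth a) (P := fun=> True)); exists h0.
have [[a0 h1] /= [sup0 min0] max0] :
    exists2 ah : {ffun M -> N} * N,
      supported ah.1 /\ (forall k, worth ah.1 ah.2 <= worth ah.1 k)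
      & forall bk : {ffun M -> N} * N,
          supported bk.1 /\ (forall k, worth bk.1 bk.2 <= worth bk.1 k) ->
          - worth ah.1 ah.2 <= - worth bk.1 bk.2.
  apply: (fin_argmin (f := fun bk : {ffun M -> N} * N => - worth bk.1 bk.2)
    (P := fun bk => supported bk.1 /\ forall k, worth bk.1 bk.2 <= worth bk.1 k)).
  have [a [w [w_gt0 sw]]] := exists_supported N_gt0.
  have [h _ hmin] := worst a.
  by exists (a, h); split=> [|k]; [exists w | exact: hmin].
set mu := worth a0 h1 in min0 max0.
(* Agents of [L] may a priori have more than [mu]; minimality of [L] will exclude this. *)
pose fair (L : {set N}) a :=
  forall h, mu <= worth a h /\ (h \notin L -> mu < worth a h).
have [[L a1] /= [sup1 fair1] L_min] :
    exists2 La : {set N} * {ffun M -> N}, supported La.2 /\ fair La.1 La.2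
      & forall Kb : {set N} * {ffun M -> N}, supported Kb.2 /\ fair Kb.1 Kb.2 ->
          (#|La.1| <= #|Kb.1|)%N.
  apply: (fin_argmin (f := fun Kb : {set N} * {ffun M -> N} => #|Kb.1|)
      (P := fun Kb => supported Kb.2 /\ fair Kb.1 Kb.2)).
  by exists (setT, a0); split=> // h; rewrite inE.
have poor_eq a l : supported a -> fair L a -> l \in L -> worth a l = mu.
  move=> sup_a fair_a lL; apply/eqP; rewrite eq_le leNgt (fair_a l).1 andbT.
  apply/negP => lt_l; have : (#|L| <= #|L :\ l|)%N.
    apply: (L_min (L :\ l, a)); split=> // h; split; first exact: (fair_a h).1.
    rewrite !inE negb_and negbK => /orP[/eqP-> //|]; exact: (fair_a h).2.
  by rewrite (cardsD1 l L) lL ltnn.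
(* With [L] empty, every bundle of [a1] would exceed [mu], the maximal least worth. *)
have [i iL] : exists i, i \in L.
  apply/set0Pn/eqP => L0; have [h _ hmin] := worst a1.
  have := max0 (a1, h) (conj sup1 (fun k => hmin k I)).
  by rewrite lerN2 leNgt (fair1 h).2 // L0 inE.
pose normed a := exists w, nweights i w a.
have normed_sup a : normed a -> supported a.
  by case=> w /nweights_pos[w' w'_gt0 sw']; exists w'.
have [a2 [nsup2 fair2] min2] :
    exists2 a, normed a /\ fair L a & forall b, normed b /\ fair L b ->
      \sum_h min_weights i a h <= \sum_h min_weights i b h.
  apply: (fin_argmin (f := fun b => \sum_h min_weights i b h)
    (P := fun b => normed b /\ fair L b)).
  exists a1; split=> //; case: sup1 => w w_gt0 sw.
  by exists (fun h => w h / w i); apply: supports_scale.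
set w := min_weights i a2 in min2.
have nw2 : nweights i w a2 by apply: min_weightsP.
(* [w] is now frozen, so the desire relation inside the potential is the same for all allocations
   compared. *)
have [a [nw_a fair_a] min_a] :
    exists2 a, nweights i w a /\ fair L a & forall b, nweights i w b /\ fair L b ->
      (potential (desires w) i a <= potential (desires w) i b)%O.
  by apply: fin_argmin; exists a2.
have sup_a : supported a by apply: normed_sup; exists w.
(* [w] may vanish at some agents, so positive weights are returned instead. *)
have [w' w'_gt0 sw'] := sup_a; exists a, w'; split=> // h k.
have [gk agk|] := pickP [pred g | a g == k]; last first.
  by move=> agk; left=> g; apply/negbT/agk.
right; apply: contrapT => no_g.
have {no_g} rich g : a g = k -> mu < worth a k - p g.
  move=> ag; apply: (le_lt_trans (fair_a h).1); rewrite ltNge.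
  by apply/negP => le_g; case: no_g; exists g.
have ki : k != i.
  apply/eqP => ki; have := rich _ (eqP agk); rewrite ki poor_eq //.
  by rewrite ltNge lerBlDr lerDl ltW.
(* [a] competed with [a2] in the choice of [w], so [w] is minimal for [a] too. *)
have w_min b : nweights i b a -> \sum_h w h <= \sum_h b h.
  move=> nb; apply: le_trans (min2 a _) _; first by split=> //; exists b.
  by apply: ler_sum => l _; apply: min_weights_le.
have wk_gt0 : 0 < w k by rewrite -(eqP agk) (nweights_holder_gt0 gk nw_a).
have [q [x [g [xq ag dxg kq]]]] := reach_step (minimal_weights_reach nw_a w_min wk_gt0) ki.
have xk : x != k by apply: contraNneq kq => <-.
have nw_a' : nweights i w (give a g x).
  by case: nw_a => w_ge0 wi sw; split=> //; apply: supports_give.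
have sup_a' : supported (give a g x) by apply: normed_sup; exists w.
have fair_a' : fair (L :\ x) (give a g x).
  move=> l; rewrite worth_give ag !inE.
  have [-> |lx] := eqVneq l x.
    rewrite (negPf (_ : k != x)) 1?eq_sym // mul0r subr0 mul1r.
    have lt_x : mu < worth a x + p g by rewrite ltr_pwDr ?(fair_a x).1.
    by rewrite ltW.
  rewrite mul0r addr0 /=.
  have [<-|_] := eqVneq k l; last by rewrite mul0r subr0; apply: fair_a.
  by rewrite mul1r; have := rich _ ag => lt_k; rewrite ltW.
have [xL|xL] := boolP (x \in L).
  have /= := L_min (L :\ x, give a g x) (conj sup_a' fair_a').
  by rewrite (cardsD1 x L) xL ltnn.
have {}fair_a' : fair L (give a g x).
  move=> l; have [le_l lt_l] := fair_a' l; split=> // lL; apply: lt_l.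
  by rewrite !inE (negPf lL) andbF.
have := min_a _ (conj nw_a' fair_a'); rewrite leEnat leqNgt => /negP; apply.
by apply: potential_give xq _; rewrite ag.
Qed.

End Market.
End SupportingWeights.

(** * Pareto optimality and removal of the perturbation *)

(** A dominating fractional allocation would raise the welfare weighted by [w], but each good
    already yields its maximal weighted utility and its shares sum to 1. *)
Lemma supports_fPO (R : realType) (N M : finType) (u : N -> {set M} -> R)
    (w : N -> R) (a : {ffun M -> N}) :
  (forall i, additive_valuation (u i)) -> (forall h, 0 < w h) ->
  supports (fun i g => u i [set g]) w a -> fPO u (fun i => [set g | a g == i]).
Proof.
move=> u_add w_gt0 /supportsP sw [A' [[A'_01 A'_sum] le_u [i lt_u]]].
have : \sum_h w h * u h [set g | a g == h]
     < \sum_h w h * fractional_utility (u h) (A' h).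
  apply: (ltr_sum1 (j := i)) => [h|]; first by rewrite ler_pM2l.
  by rewrite ltr_pM2l.
apply/negP; rewrite -leNgt.
have -> : \sum_h w h * u h [set g | a g == h] = \sum_g w (a g) * u (a g) [set g].
  rewrite (partition_big a predT) //=; apply: eq_bigr => h _.
  rewrite (u_add h).2 mulr_sumr; apply: eq_big => [g|g]; first by rewrite inE.
  by rewrite inE => /eqP ->.
under eq_bigr do rewrite mulr_sumr.
rewrite exchange_big /=; apply: ler_sum => g _.
rewrite -[leRHS]mul1r -(A'_sum g) mulr_suml; apply: ler_sum => h _.
by rewrite mulrCA ler_wpM2l //; case/andP: (A'_01 h g).
Qed.

Theorem corollary2 (R : realType) (N M : finType)
    (v : {set M} -> R) (u : N -> {set M} -> R)
    (N_nonempty : (0 < #|N|)%N)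
    (v_additive : additive_valuation v)
    (u_additive : forall i : N, additive_valuation (u i))
    (u_nonzero : forall (i : N) (g : M), 0 < u i [set g]) :
  exists A : N -> {set M}, [/\ allocation A, fPO u A & EF1 v A].
Proof.
have [v_ge0 v_sum] := v_additive.
(* [e] is at most every positive difference of market values; adding [d] to each price changes a
   bundle by less than [e]. *)
have [e /andP[e_gt0 _] e_le] :=
  fin_pos_lbound (fun ST : {set M} * {set M} => v ST.1 - v ST.2).
pose d := e / #|M|.+1%:R.
have d_gt0 : 0 < d by rewrite divr_gt0.
have p_gt0 g : 0 < v [set g] + d by rewrite ltr_wpDl.
have [a [w [w_gt0 sw ef1]]] := market_EF1 u_nonzero p_gt0 N_nonempty.
pose A i := [set g | a g == i].
have worthE i : worth (fun g => v [set g] + d) a i = v (A i) + d * #|A i|%:R.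
  rewrite /worth big_split /= v_sum; congr (_ + _).
    by apply: eq_bigl => g; rewrite inE.
  rewrite sumr_const mulr_natr; congr (d *+ _).
  by apply: eq_card => g; rewrite inE.
exists A; split.
- split=> [i j ij|].
    rewrite -setI_eq0; apply/eqP/setP => g; rewrite !inE.
    by apply/negP => /andP[/eqP ai /eqP aj]; rewrite -ai aj eqxx in ij.
  apply/setP => g; rewrite inE; apply/bigcupP; exists (a g) => //.
  by rewrite inE.
- exact: supports_fPO sw.
move=> i j; have [noj|[g agj le_g]] := ef1 i j.
  by left; apply/setP => g; rewrite !inE; apply/negbTE/noj.
right; exists g; first by rewrite inE agj.
rewrite leNgt; apply/negP => lt_v.
have gAj : g \in A j by rewrite inE agj.
have vD : v (A j) = v [set g] + v (A j :\ g).
  rewrite v_sum (big_setD1 g) //=; congr (_ + _).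
  by rewrite [RHS]v_sum.
(* EF1 for the perturbed prices leaves a deficit of at most [d * #|A i|], which is below the gap
   [e]. *)
have := e_le (A j :\ g, A i); rewrite subr_gt0 => /(_ lt_v) /= e_gap.
have : d * #|A i|%:R < e.
  rewrite /d mulrAC ltr_pdivrMr // ltr_pM2l // ltr_nat ltnS; exact: max_card.
move: le_g; rewrite !worthE vD (cardsD1 g (A j)) gAj add1n -natr1 mulrDr mulr1 /=.
have : 0 <= d * #|A j :\ g|%:R by rewrite mulr_ge0 // ltW.
lra.
Qed.
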